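(* Let $(\Omega,\Sigma,\mu;\phi)$ be a bimeasurable measure preserving dynamical system and let $P$ be its Perron-Frobenius operator on $L^1(\Omega,\Sigma,\mu)$. Then the following assertions are equivalent. (i) For all $A\in \Sigma$ the sequence $(\phi^{n}(A))_{n\in\mathbb{N}}$ converges in the measure algebra $\Sigma/\sim$. (ii) For all $f\in L^1(\Omega,\Sigma,\mu)$ the sequence $(P^nf)_{n\in\mathbb{N}}$ converges in $L^1(\Omega,\Sigma,\mu)$. (iii) $\overline{\Sigma_\infty} = \overline{\Sigma_{\mathrm{inv}}}$. Moreover, if these equivalent assertions hold, then for each $f\in L^1(\Omega,\Sigma,\mu)$ the sequence $(P^nf)_{n\in\mathbb{N}}$ converges to $\mathbb{E}(f\mid \Sigma_{\mathrm{inv}})$, and for each $A\in\Sigma$ the sequence $(\phi^n(A))_{n\in\mathbb{N}}$ converges in $\Sigma/\sim$ to the minimal invariant superset $A^*$.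
   Context: A measure preserving dynamical system $(\Omega,\Sigma,\mu;\phi)$ is a probability space $(\Omega,\Sigma,\mu)$ with a measurable map $\phi\colon\Omega\to\Omega$ such that $\mu(\phi^{-1}(A))=\mu(A)$ for all $A\in\Sigma$. It is bimeasurable if $\phi^{-1}(A)\in\Sigma$ and $\phi(A)\in\Sigma$ for all $A\in\Sigma$. The Perron-Frobenius operator $P$ is the unique linear positive operator on $L^1(\Omega,\Sigma,\mu)$ with $\int_A Pf\,d\mu=\int_{\phi^{-1}(A)}f\,d\mu$ for all $f\in L^1$, $A\in\Sigma$. On $\Sigma$ write $A\sim B$ iff $\mu(A\triangle B)=0$; the measure algebra $\Sigma/\sim$ is the set of equivalence classes with metric $d(A,B)=\mu(A\triangle B)$ (sets are identified with their classes). Let $\Sigma_n=\{\phi^{-n}(A):A\in\Sigma\}$, $\Sigma_\infty=\bigcap_{n\in\mathbb{N}}\Sigma_n$, and $\Sigma_{\mathrm{inv}}=\{A\in\Sigma:\phi^{-1}(A)=A\}$. For a sub-$\sigma$-algebra $\mathcal{G}\subseteq\Sigma$, its completion within $\Sigma$ is $\overline{\mathcal{G}}=\{A\in\Sigma: \exists B\in\mathcal{G},\ \mu(A\triangle B)=0\}$. $\mathbb{E}(f\mid\Sigma_{\mathrm{inv}})$ denotes the conditional expectation of $f$ with respect to $\Sigma_{\mathrm{inv}}$. For $A\subseteq\Omega$, the minimal invariant superset $A^*$ is the intersection of all sets $B\subseteq\Omega$ with $A\subseteq B$ and $\phi^{-1}(B)=B$ (for bimeasurable $\phi$ and $A\in\Sigma$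 this set lies in $\Sigma$). *)

(* Defs.v *)
From HB Require Import structures.
From mathcomp Require Import all_boot all_order all_algebra.
From mathcomp Require Import all_classical all_reals all_analysis.
Set Implicit Arguments. Unset Strict Implicit. Unset Printing Implicit Defensive.
Import Order.TTheory GRing.Theory Num.Theory.
Import numFieldNormedType.Exports.
Local Open Scope classical_set_scope.
Local Open Scope ring_scope.

Section Defs.
Context {d : measure_display} {T : measurableType d} {R : realType}.
Variables (mu : probability T R) (phi : T -> T).

Definition measure_preserving :=
  measurable_fun setT phi /\
  forall A, measurable A -> mu (phi @^-1` A) = mu A.

Definition bimeasurable :=
  (forall A, measurable A -> measurable (phi @^-1` A)) /\
  (forall A, measurable A -> measurable (phi @` A)).

Definition L1 (f : T -> R) := mu.-integrable setT (EFin \o f).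

(* P is (a representative-level version of) the Perron-Frobenius operator:
   it maps L^1 to L^1, is linear and positive (up to null sets) and
   int_A Pf dmu = int_{phi^-1 A} f dmu. *)
Definition perron_frobenius (P : (T -> R) -> (T -> R)) :=
  (forall f, L1 f -> L1 (P f)) /\
  (forall f g, L1 f -> L1 g ->
     {ae mu, forall x, P (f \+ g) x = P f x + P g x}) /\
  (forall (c : R) f, L1 f -> {ae mu, forall x, P (fun y => c * f y) x = c * P f x}) /\
  (forall f, L1 f -> {ae mu, forall x, 0 <= f x} -> {ae mu, forall x, 0 <= P f x}) /\
  (forall f, L1 f -> forall A, measurable A ->
     (\int[mu]_(x in A) (P f x)%:E = \int[mu]_(x in phi @^-1` A) (f x)%:E)%E).

Definition L1_cvg_to (u : nat -> T -> R) (g : T -> R) :=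
  (\int[mu]_x (`|u n x - g x|)%:E)%E @[n --> \oo] --> 0%E.

Definition malg_cvg_to (S : nat -> set T) (B : set T) :=
  mu (S n `+` B) @[n --> \oo] --> 0%E.

Definition Sigma_n (n : nat) : set (set T) :=
  [set iter n phi @^-1` A | A in measurable].

Definition Sigma_infty : set (set T) := \bigcap_n Sigma_n n.

Definition Sigma_inv : set (set T) :=
  [set A | measurable A /\ phi @^-1` A = A].

Definition completion_in (G : set (set T)) : set (set T) :=
  [set A | measurable A /\ exists2 B, G B & mu (A `+` B) = 0%E].

Definition is_cond_exp_inv (f g : T -> R) :=
  L1 g /\
  (forall B : set R, measurable B -> Sigma_inv (g @^-1` B)) /\
  (forall A, Sigma_inv A ->
     (\int[mu]_(x in A) (g x)%:E = \int[mu]_(x in A) (f x)%:E)%E).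

Definition min_inv_superset (A : set T) : set T :=
  \bigcap_(B in [set B : set T | A `<=` B /\ phi @^-1` B = B]) B.

End Defs.

(* Main.v *)
Require Import Defs.
From HB Require Import structures.
From mathcomp Require Import all_boot all_order all_algebra finmap.
From mathcomp Require Import all_classical all_reals all_analysis.
From mathcomp Require Import measurable_realfun ring lra.
Import Order.TTheory GRing.Theory Num.Theory.
Import numFieldNormedType.Exports.
Local Open Scope classical_set_scope.
Local Open Scope ring_scope.
Import HBSimple.

(**
The inverse images of the sets [phi^n A] increase to a set of [Sigma_infty];
if that set is almost invariant, then [phi^n A] converges to it in measure,
because [mu (phi^n A + B) = mu (phi^-n (phi^n A) + B)] for invariant [B].
Conversely a limit [B] of [phi^n A], for [A] in [Sigma_infty], satisfies
[mu (A + phi^-n B) -> 0], which forces [B] to be almost invariant and almost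
equal to [A]; convergence of [P^n 1_A], which is [1_(phi^n A)] almost
everywhere, provides such a limit as well.

For the convergence of [P^n f], the functions [P^n f o phi^n] are the
conditional expectations of [f] with respect to the decreasing sequence
[Sigma_n].  They form a Cauchy sequence: for bounded [f] by Pythagoras in L2,
in general by density.  The level sets of the limit [h] belong to [Sigma_infty],
so [h o phi = h] almost everywhere as soon as these sets are almost invariant,
and then [P^n f] and [h] are as far apart as [P^n f o phi^n] and [h].
*)

(** * Iterated images and preimages, and the families [Sigma_infty] and [Sigma_inv] *)

Section iterated_preimages.
Context {d : measure_display} {T : measurableType d} {R : realType}.
Variables (mu : probability T R) (phi : T -> T).

Lemma measure_preserving_iter n :
  measure_preserving mu phi -> measure_preserving mu (iter n phi).
Proof.
move=> [mphi muphi]; elim: n => [|n [mn mun]].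
  by split=> [|A mA]; [exact: measurable_id|].
split=> [|A mA]; first exact: measurableT_comp mphi mn.
rewrite -[RHS]muphi// -[RHS]mun//.
by rewrite -[X in measurable X]setTI; exact: mphi.
Qed.

Lemma measurable_preimage_mp A :
  measure_preserving mu phi -> measurable A -> measurable (phi @^-1` A).
Proof. by move=> [mphi _] mA; rewrite -[X in measurable X]setTI; exact: mphi. Qed.

Lemma measurable_image_iter n A :
  bimeasurable phi -> measurable A -> measurable (iter n phi @` A).
Proof.
move=> [_ bphi] mA; elim: n => [|n IHn].
  by rewrite (_ : _ @` A = A)//; apply/seteqP; split => [x [y ? <-]//|x ?]; exists x.
rewrite (_ : _ @` A = phi @` (iter n phi @` A)); first exact: bphi.
apply/seteqP; split => [x [y Ay <-]|x [_ [y Ay <-] <-]]; last by exists y.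
by exists (iter n phi y) => //; exists y.
Qed.

Lemma preimage_iter_inv n B : phi @^-1` B = B -> iter n phi @^-1` B = B.
Proof.
move=> BB; elim: n => // n IHn.
by rewrite -[RHS]IHn -[in RHS]BB.
Qed.

(** For every [n], a set of [Sigma_infty] is a union of fibres of [iter n phi], so pulling back its
    image adds no point. *)
Lemma Sigma_infty_image A n :
  Sigma_infty phi A -> iter n phi @^-1` (iter n phi @` A) = A.
Proof.
move=> /(_ n I)[B mB <-]; apply/seteqP; split => [x [y By]|x Bx].
  by rewrite /preimage /= => <-.
by exists x.
Qed.

Lemma Sigma_infty_measurable A : Sigma_infty phi A -> measurable A.
Proof. by move=> /(_ 0%N I)[B mB <-]. Qed.

Lemma Sigma_inv_infty : Sigma_inv phi `<=` Sigma_infty phi.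
Proof. by move=> A [mA AA] n _; exists A => //; exact: preimage_iter_inv. Qed.

End iterated_preimages.

(** * Symmetric differences and convergence in the measure algebra *)

Section symmetric_difference.
Context {d : measure_display} {T : measurableType d} {R : realType}.
Variable mu : probability T R.
Implicit Types A B C : set T.

Lemma measurable_setY A B : measurable A -> measurable B -> measurable (A `+` B).
Proof. by move=> mA mB; apply: measurableU; apply: measurableD. Qed.

Lemma measure_setY_triangle A B C :
  measurable A -> measurable B -> measurable C ->
  (mu (A `+` C) <= mu (A `+` B) + mu (B `+` C))%E.
Proof.
move=> mA mB mC.
have mAB := measurable_setY _ _ mA mB; have mBC := measurable_setY _ _ mB mC.
apply: le_trans (measureU2 _ mAB mBC).
apply: le_measure; rewrite ?inE; [exact: measurable_setY|exact: measurableU|].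
by move=> x [[xA xC]|[xC xA]]; have [xB|xB] := pselect (B x);
  [right; left|left; left|left; right|right; right].
Qed.

Lemma measure_setY0_trans A B C :
  measurable A -> measurable B -> measurable C ->
  mu (A `+` B) = 0%E -> mu (B `+` C) = 0%E -> mu (A `+` C) = 0%E.
Proof.
move=> mA mB mC AB BC; apply/eqP; rewrite -measure_le0.
by rewrite (le_trans (measure_setY_triangle _ _ _ mA mB mC))// AB BC adde0.
Qed.

Lemma malg_cvg_to_ae_eq (S : nat -> set T) B C :
  (forall n, measurable (S n)) -> measurable B -> measurable C ->
  malg_cvg_to mu S B -> mu (B `+` C) = 0%E -> malg_cvg_to mu S C.
Proof.
move=> mS mB mC SB BC; apply: (squeeze_cvge _ (@cvg_cst _ _ _ _ _) SB).
apply: nearW => n; rewrite measure_ge0/=.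
by rewrite (le_trans (measure_setY_triangle _ _ _ (mS n) mB mC))// BC adde0.
Qed.

Lemma nondecreasing_malg_cvg (S : nat -> set T) :
  (forall n, measurable (S n)) -> {homo S : n m / (n <= m)%N >-> n `<=` m} ->
  malg_cvg_to mu S (\bigcup_n S n).
Proof.
move=> mS Sle; set U := \bigcup_n S n.
have mU : measurable U by apply: bigcup_measurable.
(* As [S n] is contained in [U], the distance is [mu U - mu (S n)], and continuity from below
   applies. *)
rewrite /malg_cvg_to; suff -> : (fun n => mu (S n `+` U)) = (fun n => mu U - mu (S n))%E.
  rewrite -(subee (fin_num_measure mu U mU)).
  apply: cvgeB; [|exact: cvg_cst|].
    by rewrite fin_num_adde_defr// fin_num_measure.
  apply: nondecreasing_cvg_mu => // n m nm; apply/subsetPset; exact: Sle.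
apply/funext => n; have SU : S n `<=` U by exact: bigcup_sup.
rewrite /setY (_ : S n `\` U = set0) ?set0U; last first.
  by apply/seteqP; split => x // [/SU].
by rewrite measureD// ?setIidr// (le_lt_trans (probability_le1 _ _))// ltry.
Qed.

End symmetric_difference.

(** * Almost invariant sets and their invariant representatives *)

Section almost_invariant_sets.
Context {d : measure_display} {T : measurableType d} {R : realType}.
Variables (mu : probability T R) (phi : T -> T).
Hypotheses (phi_mp : measure_preserving mu phi).

Let mpre n A : measurable A -> measurable (iter n phi @^-1` A).
Proof. exact/(measurable_preimage_mp mu)/measure_preserving_iter. Qed.

Let mu_pre n A : measurable A -> mu (iter n phi @^-1` A) = mu A.
Proof. by have [_] := measure_preserving_iter _ _ n phi_mp; apply. Qed.

(** Consecutive iterated preimages of [B] differ by the preimage under [iter n phi] of a null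
    set. *)
Lemma almost_invariant_iter B n : measurable B ->
  mu (B `+` phi @^-1` B) = 0%E -> mu (B `+` iter n phi @^-1` B) = 0%E.
Proof.
move=> mB B0; elim: n => [|n IHn]; first by rewrite setYK measure0.
apply: (measure_setY0_trans _ _ (iter n phi @^-1` B)) => //; [exact: mpre..|].
rewrite -[RHS]B0 -[RHS](mu_pre n)//.
by apply: measurable_setY => //; exact: (mpre 1).
Qed.

(* The representative is the limit superior of the preimages of [B]. *)
Lemma almost_invariant_repr B : measurable B ->
  mu (B `+` phi @^-1` B) = 0%E ->
  exists2 C, Sigma_inv phi C & mu (B `+` C) = 0%E.
Proof.
move=> mB B0.
pose C := \bigcap_N \bigcup_(n in [set n | (N <= n)%N]) iter n phi @^-1` B.
have mC : measurable C.
  by apply: bigcapT_measurable => N; apply: bigcup_measurable => n _; exact: mpre.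
exists C.
  split=> //; apply/seteqP; split => [x Cx N _|x Cx N _].
    have [n /= Nn Bn] := Cx N I; exists n.+1 => /=; first exact: leqW.
    by rewrite /preimage -iterS iterSr.
  (* Asking for an index beyond [N.+1] makes it a successor, and its predecessor serves for
     [phi x]. *)
  have [[//|n] /= Nn Bn] := Cx N.+1 I; exists n => //=.
  by rewrite /preimage /= -iterSr.
apply: measure_negligible; first exact: measurable_setY.
(* Outside all the sets [B + phi^-n B], the orbit of a point lies either wholly in [B] or wholly
   outside it, so the point belongs to [B] exactly when it belongs to [C]. *)
apply: (@negligibleS _ _ _ _ (\bigcup_n (B `+` iter n phi @^-1` B))).
  move=> x [[Bx nCx]|[Cx nBx]].
    apply: contrapT => nU; apply: nCx => N _; exists N => //=.
    by apply: contrapT => nBN; apply: nU; exists N => //; left.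
  by have [n _ Bn] := Cx 0%N I; exists n => //; right.
apply: negligible_bigcup => n; apply/negligibleP.
  by apply: measurable_setY => //; exact: mpre.
exact: almost_invariant_iter.
Qed.

(** Converse to [almost_invariant_repr]: if [C] is invariant, then [phi^-1 B + C] is the preimage of
    [B + C], hence null with it. *)
Lemma completion_Sigma_inv_almost_invariant B :
  completion_in mu (Sigma_inv phi) B -> mu (B `+` phi @^-1` B) = 0%E.
Proof.
move=> [mB [C [mC CC] BC]].
apply: (measure_setY0_trans _ _ C) => //; first exact: (mpre 1).
by rewrite -[in X in mu X]CC setYC -[RHS]BC -[RHS](mu_pre 1)//; exact: measurable_setY.
Qed.

End almost_invariant_sets.

(** * Convergence of the images [phi^n A] in the measure algebra *)

Section image_convergence.
Context {d : measure_display} {T : measurableType d} {R : realType}.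
Variables (mu : probability T R) (phi : T -> T).
Hypotheses (phi_mp : measure_preserving mu phi) (phi_bi : bimeasurable phi).

Let mpre n A : measurable A -> measurable (iter n phi @^-1` A).
Proof. exact/(measurable_preimage_mp mu)/measure_preserving_iter. Qed.

Let mu_pre n A : measurable A -> mu (iter n phi @^-1` A) = mu A.
Proof. by have [_] := measure_preserving_iter _ _ n phi_mp; apply. Qed.

Let mim n A : measurable A -> measurable (iter n phi @` A).
Proof. exact: measurable_image_iter. Qed.

(** Lets a set be proved null by squeezing its measure, seen as a constant sequence, under a
    sequence that tends to 0. *)
Lemma cst_malg_cvg_to (A B : set T) : malg_cvg_to mu (fun=> A) B -> mu (A `+` B) = 0%E.
Proof. by move=> /(cvg_unique (@ereal_hausdorff R) (@cvg_cst _ _ _ _ _)). Qed.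

Lemma malg_limit_completion A B : Sigma_infty phi A -> measurable B ->
  malg_cvg_to mu (fun n => iter n phi @` A) B ->
  completion_in mu (Sigma_inv phi) A.
Proof.
move=> SA mB cvgB; have mA := Sigma_infty_measurable _ _ SA.
have preA n : mu (iter n phi @` A `+` B) = mu (A `+` iter n phi @^-1` B).
  rewrite -[LHS](mu_pre n); last by apply: measurable_setY => //; exact: mim.
  by rewrite -[in RHS](Sigma_infty_image phi A n).
have cvgA : (mu (A `+` iter n phi @^-1` B) @[n --> \oo] --> 0)%E.
  by move: cvgB; rewrite /malg_cvg_to; under eq_fun do rewrite preA.
(* For large [n], [A] is close to both [phi^-n B] and [phi^-(n+1) B], whose mutual distance is that
   of [B] and [phi^-1 B] whatever [n] is. *)
have B0 : mu (B `+` phi @^-1` B) = 0%E.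
  apply: cst_malg_cvg_to.
  have cvgAS : (mu (A `+` iter n.+1 phi @^-1` B) @[n --> \oo] --> 0)%E.
    by rewrite (cvg_shiftS (fun n => mu (A `+` iter n phi @^-1` B))).
  have := cvgeD _ cvgA cvgAS.
  rewrite adde0 => /(_ _ erefl); apply: squeeze_cvge (@cvg_cst _ _ _ _ _).
  apply: nearW => n; rewrite measure_ge0/=.
  rewrite -(mu_pre n); last by apply: measurable_setY => //; exact: (mpre 1).
  rewrite [X in (_ <= X + _)%E](_ : _ = mu (iter n phi @^-1` B `+` A)); last by rewrite setYC.
  by apply: measure_setY_triangle => //; [exact: mpre|exact: (mpre n.+1)].
have [C invC BC] := almost_invariant_repr _ _ phi_mp _ mB B0.
split => //; exists C => //; have mC : measurable C by case: invC.
(* Now [phi^-n B] is almost equal to [B], so the distance from [A] to [B] is bounded by terms that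
   tend to 0. *)
apply: (measure_setY0_trans _ _ B) => //; apply: cst_malg_cvg_to.
move: cvgA; apply: squeeze_cvge (@cvg_cst _ _ _ _ _).
apply: nearW => n; rewrite measure_ge0/=.
rewrite (le_trans (measure_setY_triangle _ _ (iter n phi @^-1` B) _ _ _ _))//.
  exact: mpre.
by rewrite [X in (_ + X)%E](_ : _ = 0%E) ?adde0// setYC almost_invariant_iter.
Qed.

(** Invariant sets lie in [Sigma_infty], so one inclusion of completions is automatic. The other
    only has to be checked on [Sigma_infty] itself, the form in which assertion (iii) is used
    below. *)
Lemma completion_Sigma_infty_invE :
  (forall A, Sigma_infty phi A -> completion_in mu (Sigma_inv phi) A) <->
  completion_in mu (Sigma_infty phi) = completion_in mu (Sigma_inv phi).
Proof.
split=> [infI|infI A SA]; last first.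
  have mA := Sigma_infty_measurable _ _ SA.
  by rewrite -infI; split => //; exists A => //; rewrite setYK measure0.
apply/seteqP; split => A [mA [B SB AB]].
  have [mB [C invC BC]] := infI _ SB; split => //; exists C => //.
  by apply: (measure_setY0_trans _ _ B) => //; case: invC.
by split=> //; exists B => //; exact: Sigma_inv_infty.
Qed.

(** The right-hand side collects the points whose orbit meets an orbit starting in [A]. Being a
    countable union, it gives the measurability that the arbitrary intersection hides. *)
Lemma min_inv_supersetE A : min_inv_superset phi A =
  \bigcup_m iter m phi @^-1` (\bigcup_n iter n phi @` A).
Proof.
apply/seteqP; split => [x|x [m _ [n _ [a Aa anx]]] B [AB BB]]; last first.
  rewrite -(preimage_iter_inv _ m _ BB) /preimage/= -anx.
  by have : (iter n phi @^-1` B) a by rewrite preimage_iter_inv//; exact: AB.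
apply; split => [y Ay|]; first by exists 0%N => //; exists 0%N => //; exists y.
(* A step forward from [y] to [phi y] is absorbed by the index [n] of the image, a step backward by
   the index [m] of the preimage. *)
apply/seteqP; split => y [m _ [n _ [a Aa any]]].
  by exists m.+1 => //; exists n => //; exists a => //; rewrite any iterSr.
by exists m => //; exists n.+1 => //; exists a => //; rewrite -iterSr !iterS any.
Qed.

Lemma malg_cvg_min_inv_superset A : measurable A ->
  (forall B, Sigma_infty phi B -> completion_in mu (Sigma_inv phi) B) ->
  measurable (min_inv_superset phi A) /\
  malg_cvg_to mu (fun n => iter n phi @` A) (min_inv_superset phi A).
Proof.
move=> mA infI; pose S n := iter n phi @^-1` (iter n phi @` A).
have mS n : measurable (S n) by apply: mpre; exact: mim.
have mU : measurable (\bigcup_n S n) by exact: bigcup_measurable.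
have S_nd : {homo S : n m / (n <= m)%N >-> n `<=` m}.
  move=> n m nm x [a Aa anx]; exists a => //.
  by rewrite -(subnK nm) !iterD anx.
have SU : Sigma_infty phi (\bigcup_n S n).
  (* The sets [S n] increase, so dropping the first [m] of them keeps the union, and [S (n + m)] is
     a preimage under [iter m phi]. *)
  move=> m _; exists (\bigcup_n iter n phi @^-1` (iter (n + m) phi @` A)).
    by apply: bigcup_measurable => n _; apply: mpre; exact: mim.
  apply/seteqP; split => x [n _ [a Aa anx]].
    by exists (n + m)%N => //; exists a => //; rewrite anx iterD.
  have [b Ab bx] := S_nd _ _ (leq_addr m n) x (ex_intro2 _ _ a Aa anx).
  by exists n => //; exists b => //; rewrite bx iterD.
have [_ [B [mB BB] UB]] := infI _ SU.
have SB : malg_cvg_to mu (fun n => iter n phi @` A) B.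
  have := malg_cvg_to_ae_eq _ _ _ _ mS mU mB (nondecreasing_malg_cvg _ _ mS S_nd) UB.
  rewrite /malg_cvg_to (_ : (fun n => mu (S n `+` B)) =
    (fun n => mu (iter n phi @` A `+` B)))//; apply/funext => n.
  rewrite -[RHS](mu_pre n); last by apply: measurable_setY => //; exact: mim.
  by rewrite -[in LHS](preimage_iter_inv _ n _ BB).
have mA' : measurable (min_inv_superset phi A).
  rewrite min_inv_supersetE; apply: bigcup_measurable => m _; apply: mpre.
  by apply: bigcup_measurable => n _; exact: mim.
split=> //; apply: malg_cvg_to_ae_eq SB _ => //; first by move=> n; exact: mim.
apply: measure_negligible; first exact: measurable_setY.
apply: negligibleU.
  (* The part of [B] outside [A^*] is null because [A^*] contains the union of the [S n], which is
     almost equal to [B]. *)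
  apply: (negligibleS _ (_ : mu.-negligible (\bigcup_n S n `+` B))); last first.
    by apply/negligibleP => //; exact: measurable_setY.
  move=> x [Bx nAx]; right; split => // -[n _ [a Aa anx]]; apply: nAx.
  by rewrite min_inv_supersetE; exists n => //; exists n => //; exists a.
(* The rest of [A^*] is a countable union of preimages of the sets [phi^n A \ B]. Each of these has
   the measure of its preimage [S n \ B], a part of a null set. *)
rewrite min_inv_supersetE setD_bigcupl; apply: negligible_bigcup => m.
have -> : iter m phi @^-1` (\bigcup_n iter n phi @` A) `\` B =
    \bigcup_n iter m phi @^-1` (iter n phi @` A `\` B).
  by rewrite -preimage_bigcup -setD_bigcupl -[in LHS](preimage_iter_inv _ m _ BB).
apply: negligible_bigcup => n.
have mD : measurable (iter n phi @` A `\` B) by apply: measurableD => //; exact: mim.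
apply/negligibleP; first exact: mpre.
apply: etrans (mu_pre m _ mD) _; rewrite -(mu_pre n)//.
apply: (subset_measure0 _ _ _ UB); [exact: mpre|exact: measurable_setY|].
by move=> x [Anx nBx]; left; split; [exists n|rewrite -(preimage_iter_inv _ n _ BB)].
Qed.

End image_convergence.

(** A real-valued integral is 0 by convention when the integral is infinite; hence the [L1]
    hypotheses of the triangle inequality and of [dist1_eq0]. *)
Definition dist1 {d} {T : measurableType d} {R : realType}
  (mu : probability T R) (f g : T -> R) : R := \int[mu]_x `|f x - g x|.

(** * Integrable functions and the distance of L1 *)

Section integrable_functions.
Context {d : measure_display} {T : measurableType d} {R : realType}.
Variable mu : probability T R.
Implicit Types f g h : T -> R.

Lemma L1_measurable f : L1 mu f -> measurable_fun setT f.
Proof. by move=> /(measurable_int mu) /measurable_EFinP. Qed.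

Lemma L1_measurable_ge f a : L1 mu f -> measurable [set x | a <= f x].
Proof.
move=> /L1_measurable/(_ measurableT _ (measurable_itv `[a, +oo[)).
rewrite setTI (_ : _ @^-1` _ = [set x | a <= f x])//.
by apply/seteqP; split => x; rewrite /= in_itv/= andbT.
Qed.

Lemma L1_le f g : measurable_fun setT f -> (forall x, `|f x| <= `|g x|) ->
  L1 mu g -> L1 mu f.
Proof.
move=> mf fg; apply: le_integrable => //; first exact/measurable_EFinP.
by move=> x _ /=; rewrite lee_fin.
Qed.

Lemma L1_bounded f M : measurable_fun setT f -> (forall x, `|f x| <= M) -> L1 mu f.
Proof.
move=> mf fM; apply: (L1_le _ (cst M)) => // [x|].
  by rewrite (le_trans (fM x))// ler_norm.
exact: finite_measure_integrable_cst.
Qed.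

Lemma L1D f g : L1 mu f -> L1 mu g -> L1 mu (fun x => f x + g x).
Proof.
move=> Lf Lg; have := integrableD measurableT Lf Lg.
by apply: eq_integrable => // x _.
Qed.

Lemma L1B f g : L1 mu f -> L1 mu g -> L1 mu (fun x => f x - g x).
Proof.
move=> Lf Lg; have := integrableB measurableT Lf Lg.
by apply: eq_integrable => // x _.
Qed.

Lemma L1Z c f : L1 mu f -> L1 mu (fun x => c * f x).
Proof.
move=> Lf; have := integrableZl measurableT c Lf.
by apply: eq_integrable => // x _.
Qed.

Lemma L1_norm f : L1 mu f -> L1 mu (fun x => `|f x|).
Proof. exact: integrable_norm. Qed.

Lemma L1_in f A : measurable A -> L1 mu f -> mu.-integrable A (EFin \o f).
Proof. by move=> mA; apply: integrableS. Qed.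

Lemma L1_Rintegral f A : measurable A -> L1 mu f ->
  (\int[mu]_(x in A) (f x)%:E = (\int[mu]_(x in A) f x)%:E)%E.
Proof. by move=> mA Lf; rewrite fineK//; exact/integrable_fin_num/L1_in. Qed.

Lemma Rintegral_setC f A : measurable A -> L1 mu f ->
  \int[mu]_x f x = \int[mu]_(x in A) f x + \int[mu]_(x in ~` A) f x.
Proof.
move=> mA Lf; rewrite -(setUv A) Rintegral_setU//; first exact: measurableC.
  by rewrite setUv.
by apply/disj_setPCl.
Qed.

Lemma ae_eq_Rintegral_in A f g : measurable A -> L1 mu f -> L1 mu g ->
  {ae mu, forall x, f x = g x} -> \int[mu]_(x in A) f x = \int[mu]_(x in A) g x.
Proof.
move=> mA Lf Lg fg; congr fine; apply: ae_eq_integral => //.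
- by have := L1_in _ _ mA Lf => /(measurable_int mu).
- by have := L1_in _ _ mA Lg => /(measurable_int mu).
- by apply: filterS fg => x /= -> _.
Qed.

Lemma dist1_ge0 f g : 0 <= dist1 mu f g.
Proof. by apply: Rintegral_ge0. Qed.

Lemma dist1C f g : dist1 mu f g = dist1 mu g f.
Proof. by apply: eq_Rintegral => x _; rewrite distrC. Qed.

Lemma dist1_triangle f g h : L1 mu f -> L1 mu g -> L1 mu h ->
  dist1 mu f h <= dist1 mu f g + dist1 mu g h.
Proof.
move=> Lf Lg Lh; rewrite /dist1 -RintegralD//; [|exact/L1_norm/L1B..].
apply: le_Rintegral => //; [exact/L1_norm/L1B|apply: L1D; exact/L1_norm/L1B|].
by move=> x _; exact: ler_distD.
Qed.

Lemma ae_eq_dist1 f g : L1 mu f -> L1 mu g ->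
  {ae mu, forall x, f x = g x} -> dist1 mu f g = 0.
Proof.
move=> Lf Lg fg; have L0 : L1 mu (cst 0) by apply: (L1_bounded _ 0) => // x; rewrite normr0.
rewrite (_ : 0 = \int[mu]_x (cst 0 x)); last by rewrite Rintegral_cst ?mul0r.
apply: ae_eq_Rintegral_in => //; first exact/L1_norm/L1B.
by apply: filterS fg => x /= ->; rewrite subrr normr0.
Qed.

Lemma dist1_eq0 f g : L1 mu f -> L1 mu g -> dist1 mu f g <= 0 ->
  {ae mu, forall x, f x = g x}.
Proof.
move=> Lf Lg fg; have Lfg := L1B _ _ Lf Lg.
have /ae_eq_integral_abs : (\int[mu]_x `|(f x - g x)%:E|)%E = 0%E.
  have -> : (\int[mu]_x `|(f x - g x)%:E|)%E = (dist1 mu f g)%:E.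
    by rewrite -L1_Rintegral//; exact: L1_norm.
  by congr EFin; apply/eqP; rewrite eq_le fg dist1_ge0.
move=> /(_ measurableT) []; first exact: (measurable_int mu).
by move=> N [mN N0 fgN]; exists N; split => // x /= nfg; apply: fgN => /= /(_ I) [] /eqP; rewrite subr_eq0 => /eqP.
Qed.

Lemma L1_cvg_toP (u : nat -> T -> R) g : (forall n, L1 mu (u n)) -> L1 mu g ->
  L1_cvg_to mu u g <-> forall e, 0 < e -> \forall n \near \oo, dist1 mu (u n) g <= e.
Proof.
move=> Lu Lg; rewrite /L1_cvg_to.
under eq_fun do rewrite (L1_Rintegral _ setT measurableT (L1_norm _ (L1B _ _ (Lu _) Lg))).
rewrite -/(dist1 mu _ g); split => [/fine_cvgP[_ /cvgrPdist_le ug] e e0|ug].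
  move: (ug _ e0); apply: filterS => n /=.
  by rewrite sub0r normrN ger0_norm// dist1_ge0.
apply: cvg_EFin; first exact: nearW.
apply/cvgrPdist_le => e e0; move: (ug _ e0); apply: filterS => n /=.
by rewrite sub0r normrN ger0_norm// dist1_ge0.
Qed.

Lemma Rintegral_indic_mul f A : measurable A ->
  \int[mu]_x (f x * \1_A x) = \int[mu]_(x in A) f x.
Proof.
move=> mA; rewrite [RHS]Rintegral_mkcond; apply: eq_Rintegral => x _.
by rewrite patchE indicE; case: (x \in A); rewrite ?mulr1 ?mulr0.
Qed.

Lemma dist1_indic A B : measurable A -> measurable B ->
  (dist1 mu \1_A \1_B)%:E = mu (A `+` B).
Proof.
move=> mA mB; have mAB := measurable_setY _ _ mA mB.
have L1i C : measurable C -> L1 mu \1_C by exact: integrable_indic.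
rewrite -(setIT (A `+` B)) -integral_indic// L1_Rintegral//; last exact: L1i.
congr EFin; apply: eq_Rintegral => x _; rewrite !indicE in_setU !in_setD.
by case: (x \in A); case: (x \in B); rewrite /= ?subrr ?subr0 ?sub0r ?normrN ?normr0 ?normr1.
Qed.

Lemma L1_sfun_approx f e : L1 mu f -> 0 < e ->
  exists s : {sfun T >-> R}, L1 mu s /\ dist1 mu f s <= e.
Proof.
move=> Lf e0.
have [s [Ls _ /fine_cvgP[_ /cvgrPdist_le/(_ _ e0)[n _ fs]]]] :=
  approximation_sfun_integrable measurableT Lf.
exists (s n); split; first exact: Ls.
have := fs n (leqnn n); rewrite /= sub0r normrN; apply: le_trans.
exact: ler_norm.
Qed.

End integrable_functions.

(** * Composition with a measure preserving map *)

Section composition.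
Context {d : measure_display} {T : measurableType d} {R : realType}.
Variables (mu : probability T R) (theta : T -> T).
Hypothesis theta_mp : measure_preserving mu theta.
Implicit Types f g h : T -> R.

Let mtheta : measurable_fun setT theta. Proof. by case: theta_mp. Qed.
Let thetaM_subdef := isMeasurableFun.Build _ _ _ _ theta mtheta.
Let thetaM : {mfun T >-> T} := HB.pack theta thetaM_subdef.

Lemma measurable_fun_comp_mp f : measurable_fun setT f ->
  measurable_fun setT (fun x => f (theta x)).
Proof. by move=> mf; apply: measurableT_comp. Qed.

Lemma L1_comp f : L1 mu f -> L1 mu (fun x => f (theta x)).
Proof.
move=> Lf; have mf := L1_measurable _ _ Lf.
apply/integrableP; split; first exact/measurable_EFinP/measurable_fun_comp_mp.
have /integrableP[_] := Lf; apply: le_lt_trans.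
(* Change of variables: the image of [mu] under [theta] is [mu] itself. *)
rewrite -[X in (X <= _)%E](@ge0_integral_pushforward _ _ _ _ _ thetaM mtheta mu setT (fun x => `|(f x)%:E|%E))//; last exact/measurableT_comp/measurable_EFinP.
rewrite (eq_measure_integral mu)// => A mA _.
by have [_] := theta_mp; apply.
Qed.

Lemma Rintegral_comp f A : measurable A -> L1 mu f ->
  \int[mu]_(x in theta @^-1` A) f (theta x) = \int[mu]_(x in A) f x.
Proof.
move=> mA Lf; have mf := L1_measurable _ _ Lf; congr fine.
rewrite -(@integral_pushforward _ _ _ _ _ thetaM mtheta mu A (EFin \o f))//.
- by apply: eq_measure_integral => B mB _; have [_] := theta_mp; apply.
- exact/measurable_EFinP.
- exact/L1_in/L1_comp/Lf/(measurable_preimage_mp mu).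
Qed.

Lemma dist1_comp f g : L1 mu f -> L1 mu g ->
  dist1 mu (fun x => f (theta x)) (fun x => g (theta x)) = dist1 mu f g.
Proof.
move=> Lf Lg; rewrite /dist1 -[RHS](Rintegral_comp _ setT)//.
exact/L1_norm/L1B.
Qed.

End composition.

(* [g] is the density of the image under [theta] of the signed measure with
   density [f], that is, a version of [P^n f] when [theta] is [phi^n]. *)
Definition transfer {d} {T : measurableType d} {R : realType}
    (mu : probability T R) (theta : T -> T) (f g : T -> R) :=
  [/\ L1 mu f, L1 mu g & forall A, measurable A ->
    \int[mu]_(x in A) g x = \int[mu]_(x in theta @^-1` A) f x].

(** * Contraction, positivity and duality of the transfer relation *)

Section transfer_theory.
Context {d : measure_display} {T : measurableType d} {R : realType}.
Variables (mu : probability T R) (theta : T -> T).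
Hypothesis theta_mp : measure_preserving mu theta.
Implicit Types (f g h : T -> R) (M : R).

Let mpre A : measurable A -> measurable (theta @^-1` A).
Proof. exact: (measurable_preimage_mp mu). Qed.

Lemma transferB f f' g g' : transfer mu theta f g -> transfer mu theta f' g' ->
  transfer mu theta (fun x => f x - f' x) (fun x => g x - g' x).
Proof.
move=> [Lf Lg fg] [Lf' Lg' fg']; split; [exact: L1B|exact: L1B|move=> A mA].
have mB := mpre _ mA.
by rewrite !RintegralB ?fg ?fg'//; exact: L1_in.
Qed.

(** On the set where [g] is nonnegative, and on its complement, the integral of [|g|] is up to sign
    an integral of [f] over the preimage, so at most that of [|f|] there. *)
Lemma transfer_contraction f g : transfer mu theta f g ->
  \int[mu]_x `|g x| <= \int[mu]_x `|f x|.
Proof.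
move=> [Lf Lg fg]; pose A := [set x | 0 <= g x].
have mA : measurable A by exact: (L1_measurable_ge _ _ _ Lg).
have mB := mpre _ mA; have mAC := measurableC mA; have mBC := measurableC mB.
rewrite (Rintegral_setC mu _ A mA (L1_norm _ _ Lg)).
rewrite (Rintegral_setC mu _ _ mB (L1_norm _ _ Lf)).
have le_norm (C : set T) (k : T -> R) : measurable C -> L1 mu k ->
    \int[mu]_(x in C) k x <= \int[mu]_(x in C) `|k x|.
  move=> mC Lk; apply: (le_trans (ler_norm _)).
  by apply: le_normr_Rintegral => //; exact: L1_in.
apply: lerD.
  rewrite (@eq_Rintegral _ _ _ mu A g); last by move=> x /set_mem Ax; rewrite ger0_norm//; exact: Ax.
  by rewrite fg//; exact: le_norm.
rewrite (@eq_Rintegral _ _ _ mu (~` A) (fun x => -1 * g x)); last first.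
  move=> x /set_mem/= /negP; rewrite -ltNge => /ltW gx0.
  by rewrite ler0_norm// mulN1r.
rewrite RintegralZl//; last exact: L1_in.
rewrite fg// mulN1r; apply: (le_trans (ler_norm _)); rewrite normrN.
by apply: le_normr_Rintegral => //; exact: L1_in.
Qed.

Lemma dist1_transfer f f' g g' :
  transfer mu theta f g -> transfer mu theta f' g' ->
  dist1 mu g g' <= dist1 mu f f'.
Proof. by move=> fg fg'; exact/transfer_contraction/transferB. Qed.

Lemma transfer_ae_eq f f' g g' : transfer mu theta f g -> L1 mu f' -> L1 mu g' ->
  {ae mu, forall x, f x = f' x} -> {ae mu, forall x, g x = g' x} ->
  transfer mu theta f' g'.
Proof.
move=> [Lf Lg fg] Lf' Lg' ff' gg'; split => // A mA.
rewrite -(ae_eq_Rintegral_in _ A g g')// fg//.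
by apply: ae_eq_Rintegral_in => //; exact: mpre.
Qed.

Lemma transfer_cst (M : R) : transfer mu theta (cst M) (cst M).
Proof.
have LM : L1 mu (cst M) by apply: (L1_bounded _ _ `|M|).
split=> // A mA; rewrite !Rintegral_cst//; last exact: mpre.
by have [_ muE] := theta_mp; congr (_ * fine _); exact/esym/muE.
Qed.

(** The positive part [h] of [g] has the integral of [g] over [A], which is the integral of [f] over
    a preimage, hence at most 0. *)
Lemma transfer_le0 f g : transfer mu theta f g -> (forall x, f x <= 0) ->
  {ae mu, forall x, g x <= 0}.
Proof.
move=> [Lf Lg fg] f0; pose A := [set x | 0 <= g x].
have mA : measurable A by exact: (L1_measurable_ge _ _ _ Lg).
pose h x := Num.max (g x) 0.
have Lh : L1 mu h.
  apply: (L1_le _ _ g) => //.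
    by apply: measurable_maxr => //; exact: (L1_measurable mu).
  by move=> x; rewrite /h; case: (leP (g x) 0); rewrite ?normr0.
have L0 : L1 mu (cst 0) by apply: (L1_bounded _ _ 0) => // x; rewrite normr0.
have : dist1 mu h (cst 0) <= 0.
  have -> : dist1 mu h (cst 0) = \int[mu]_(x in A) g x.
    rewrite Rintegral_mkcond; apply: eq_Rintegral => x _.
    rewrite /h subr0 patchE; case: (leP (g x) 0); case: ifPn.
    - by move=> /set_mem/= g0 g0'; rewrite normr0; apply/eqP; rewrite eq_le g0 g0'.
    - by rewrite normr0.
    - by move=> _ g0; rewrite gtr0_norm.
    - by move=> /negP nA g0; case: nA; apply: mem_set; exact: ltW.
  rewrite fg//.
  have -> : 0 = \int[mu]_(x in theta @^-1` A) (cst 0) x :> R.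
    by rewrite Rintegral_cst ?mul0r//; exact: mpre.
  by apply: le_Rintegral => //; [exact: mpre|exact: L1_in (mpre _ mA) _..].
move=> /(dist1_eq0 _ _ _ Lh L0); apply: filterS => x /=.
by rewrite /h => <-; rewrite le_max lexx.
Qed.

(** The constants [M] and [- M] transfer to themselves, so comparison with them bounds [g] almost
    everywhere; clipping makes the bound hold at every point. *)
Lemma transfer_bounded_version f g M : transfer mu theta f g ->
  (forall x, `|f x| <= M) ->
  exists2 q, {ae mu, forall x, g x = q x} &
    measurable_fun setT q /\ forall x, `|q x| <= M.
Proof.
move=> fg fM; have [Lf Lg _] := fg.
have g_le := transfer_le0 _ _ (transferB _ _ _ _ fg (transfer_cst M)).
have g_ge := transfer_le0 _ _ (transferB _ _ _ _ (transfer_cst (- M)) fg).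
have M0 : 0 <= M by apply: le_trans (fM point); exact: normr_ge0.
exists (fun x => Num.max (- M) (Num.min M (g x))).
  apply: filterS2 (g_le _) (g_ge _) => [x|x|x]/=.
  - by rewrite subr_le0 subr_le0 => gM Mg; rewrite (min_idPr gM) (max_idPr Mg).
  - by rewrite subr_le0 (le_trans (ler_norm _)).
  - rewrite subr_le0 lerNl; apply: le_trans (fM x).
    by rewrite -normrN ler_norm.
split.
  by apply: measurable_maxr => //; apply: measurable_minr => //; exact: (L1_measurable mu).
move=> x; rewrite ler_norml le_max lexx/= ge_max.
by rewrite ge_min lexx/= andbT (le_trans _ M0)// oppr_le0.
Qed.

Lemma L1M f h M : measurable_fun setT f -> (forall x, `|f x| <= M) ->
  L1 mu h -> L1 mu (fun x => f x * h x).
Proof.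
move=> mf fM Lh; apply: (L1_le _ _ (fun x => M * h x)).
- by apply: measurable_funM => //; exact: (L1_measurable mu).
- move=> x; rewrite !normrM ler_wpM2r//.
  by rewrite (le_trans (fM x))// ler_norm.
- exact: L1Z.
Qed.

(** For the indicator of a set this is the defining identity of [transfer]; linearity does the
    rest. *)
Lemma transfer_simple f g M (s : {sfun T >-> R}) :
  transfer mu theta f g -> (forall x, `|f x| <= M) -> (forall x, `|g x| <= M) ->
  L1 mu s /\ \int[mu]_x (g x * s x) = \int[mu]_x (f x * s (theta x)).
Proof.
move=> [Lf Lg fg] fM gM.
have mf := L1_measurable _ _ Lf; have mg := L1_measurable _ _ Lg.
(* The induction runs over an arbitrary list of values; the enumerated range of [s] gives back
   [s]. *)
pose F (r : seq R) x := \sum_(y <- r) y * \1_(s @^-1` [set y]) x : R.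
have sE x : s x = F (fset_set (range s)) x.
  by rewrite fimfunE fsbig_finite//=.
suff F_dual r : L1 mu (F r) /\
    \int[mu]_x (g x * F r x) = \int[mu]_x (f x * F r (theta x)).
  have [LF gF] := F_dual (fset_set (range s)).
  rewrite (_ : (s : T -> R) = F (fset_set (range s))); last exact/funext.
  by split.
elim: r => [|y r [LF IHr]].
  rewrite (_ : F [::] = cst 0); last by apply/funext => x; rewrite /F big_nil.
  split; first by apply: (L1_bounded _ _ 0) => // x; rewrite normr0.
  by apply: congr1; under eq_fun do rewrite mulr0; under [in RHS]eq_fun do rewrite mulr0.
pose B := s @^-1` [set y]; have mB : measurable B by exact: measurable_sfunP.
have L1B' : L1 mu \1_B by exact: integrable_indic.
have LZ : L1 mu (fun x => y * \1_B x) by exact: L1Z.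
have -> : F (y :: r) = fun x => y * \1_B x + F r x.
  by apply/funext => x; rewrite /F big_cons.
split; first exact: L1D.
under eq_Rintegral do rewrite mulrDr.
under [RHS]eq_Rintegral do rewrite mulrDr.
have LFt := L1_comp _ _ theta_mp _ LF.
have LZt := L1_comp _ _ theta_mp _ LZ.
rewrite !RintegralD//; try by [exact: (L1M _ _ M)|exact: (L1M _ _ M _ _ LFt)|
  exact: (L1M _ _ M _ _ LZt)].
rewrite IHr; congr (_ + _).
under eq_Rintegral do rewrite mulrCA.
under [RHS]eq_Rintegral do rewrite mulrCA.
rewrite !RintegralZl//; last 2 first.
- exact: (L1M _ _ M _ _ (L1_comp _ _ theta_mp _ L1B')).
- exact: (L1M _ _ M).
rewrite Rintegral_indic_mul// fg//.
by rewrite -(Rintegral_indic_mul _ f)//; exact: mpre.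
Qed.

(** The passage from [f] to [g] is adjoint to composition with [theta]. Both sides are Lipschitz in
    [h] for the L1 distance, so simple functions suffice. *)
Lemma transfer_duality f g h M :
  transfer mu theta f g -> (forall x, `|f x| <= M) -> (forall x, `|g x| <= M) ->
  L1 mu h -> \int[mu]_x (g x * h x) = \int[mu]_x (f x * h (theta x)).
Proof.
move=> fg fM gM Lh; have [Lf Lg _] := fg.
have mf := L1_measurable _ _ Lf; have mg := L1_measurable _ _ Lg.
have M0 : 0 <= M by apply: le_trans (fM point); exact: normr_ge0.
have Lht := L1_comp _ _ theta_mp _ Lh.
have mul_dist (k u v : T -> R) : measurable_fun setT k -> (forall x, `|k x| <= M) ->
    L1 mu u -> L1 mu v ->
    `|\int[mu]_x (k x * u x) - \int[mu]_x (k x * v x)| <= M * dist1 mu u v.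
  move=> mk kM Lu Lv; rewrite -RintegralB//; [|exact: (L1M _ _ M)..].
  rewrite /dist1 -RintegralZl//; last exact/L1_norm/L1B.
  have Lkuv : L1 mu (fun x => k x * u x - k x * v x).
    by apply: L1B; exact: (L1M _ _ M).
  apply: (le_trans (le_normr_Rintegral measurableT Lkuv)).
  apply: le_Rintegral => //; first exact: L1_norm.
    exact/L1Z/L1_norm/L1B.
  by move=> x _; rewrite -mulrBr normrM ler_wpM2r.
apply/eqP; rewrite -subr_eq0 -normr_le0; apply/ler_addgt0Pl => e e0; rewrite addr0.
(* Replacing [h] by [s] costs at most [M * dist1 mu h s] on each side; the added 1 keeps the divisor
   positive when [M] is 0. *)
have d0 : 0 < e / (2 * M + 1) by rewrite divr_gt0// ltr_wpDl// mulr_ge0.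
have [s [_ hs]] := L1_sfun_approx _ _ _ Lh d0.
have [Ls gs] := transfer_simple _ _ _ s fg fM gM.
have Lst := L1_comp _ _ theta_mp _ Ls.
have hs1 := mul_dist _ _ _ mg gM Lh Ls.
have hs2 := mul_dist _ _ _ mf fM Lst Lht.
rewrite dist1C (dist1_comp _ _ theta_mp _ _ Lh Ls) in hs2.
rewrite -(subrKA (\int[mu]_x (g x * s x))) {2}gs.
apply: (le_trans (ler_normD _ _)); apply: (le_trans (lerD hs1 hs2)).
rewrite -mulr2n -mulr_natl mulrA; apply: (@le_trans _ _ ((2 * M + 1) * dist1 mu h s)).
  by rewrite ler_wpM2r ?dist1_ge0// lerDl.
by rewrite mulrC -ler_pdivlMr// ltr_wpDl// mulr_ge0.
Qed.

End transfer_theory.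

(** * Square-integral estimates for bounded functions *)

Section transfer_L2.
Context {d : measure_display} {T : measurableType d} {R : realType}.
Variables (mu : probability T R) (theta : T -> T).
Hypothesis theta_mp : measure_preserving mu theta.
Implicit Types (f g : T -> R) (M : R).

Lemma L1_transfer_sqr f g M : transfer mu theta f g ->
  (forall x, `|f x| <= M) -> (forall x, `|g x| <= M) ->
  L1 mu (fun x => (f x - g (theta x)) ^+ 2).
Proof.
move=> [Lf Lg _] fM gM; apply: (L1_bounded _ _ ((2 * M) ^+ 2)) => [|x].
  apply: measurable_funX; apply: measurable_funB; first exact: (L1_measurable mu).
  exact/(L1_measurable mu)/L1_comp.
rewrite normrX lerXn2r ?nnegrE// ?mulr_ge0// ?(le_trans _ (fM x))//.
by rewrite (le_trans (ler_normB _ _))// mulr_natl mulr2n lerD.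
Qed.

(* [g o theta] is the orthogonal projection of [f]. *)
Lemma transfer_pythagoras f g M : transfer mu theta f g ->
  (forall x, `|f x| <= M) -> (forall x, `|g x| <= M) ->
  \int[mu]_x (f x - g (theta x)) ^+ 2 =
  \int[mu]_x (f x * f x) - \int[mu]_x (g x * g x).
Proof.
move=> fg fM gM; have [Lf Lg _] := fg.
have mf := L1_measurable _ _ Lf; have mg := L1_measurable _ _ Lg.
have Lgt := L1_comp _ _ theta_mp _ Lg.
have Lff := L1M _ _ _ M mf fM Lf; have Lgg := L1M _ _ _ M mg gM Lg.
have Lfgt := L1M _ _ _ M mf fM Lgt.
have Lggt := L1_comp _ _ theta_mp _ Lgg.
under eq_Rintegral => x _.
  rewrite (_ : _ ^+ 2 = f x * f x - 2 * (f x * g (theta x)) + g (theta x) * g (theta x)).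
    over.
  by ring.
rewrite RintegralD//; last by apply: L1B => //; exact: L1Z.
rewrite RintegralB//; last exact: L1Z.
(* Duality with [h = g] turns the cross term into the integral of [g * g]. *)
rewrite RintegralZl// -(transfer_duality _ _ theta_mp _ _ _ _ fg fM gM Lg).
rewrite (_ : \int[mu]_x (g (theta x) * g (theta x)) = \int[mu]_x (g x * g x)).
  by ring.
by rewrite -[RHS](Rintegral_comp _ _ theta_mp _ _ measurableT Lgg).
Qed.

(* [t <= e + t ^+ 2 / e] *)
Lemma dist1_transfer_L2 f g M e : transfer mu theta f g ->
  (forall x, `|f x| <= M) -> (forall x, `|g x| <= M) -> 0 < e ->
  dist1 mu f (fun x => g (theta x)) <=
  e + (\int[mu]_x (f x * f x) - \int[mu]_x (g x * g x)) / e.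
Proof.
move=> fg fM gM e0; have [Lf Lg _] := fg.
have Lgt := L1_comp _ _ theta_mp _ Lg.
have L2 := L1_transfer_sqr _ _ _ fg fM gM.
have Le : L1 mu (cst e) by apply: (L1_bounded _ _ `|e|).
have Ie : \int[mu]_x (cst e x) = e.
  rewrite Rintegral_cst// (_ : fine _ = 1) ?mulr1//.
  by transitivity (fine (1%E : \bar R)) => //; congr fine; exact: probability_setT.
rewrite -[X in X + _]Ie -(transfer_pythagoras _ _ _ fg fM gM) mulrC.
rewrite -RintegralZl// -RintegralD//; last exact: L1Z.
apply: le_Rintegral => //; [exact/L1_norm/L1B|apply: L1D => //; exact: L1Z|].
move=> x _; rewrite -real_normK ?num_real//; set t := `|f x - g (theta x)|.
rewrite -lerBlDl mulrC ler_pdivlMr//= mulrBl lerBlDr.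
have : 0 <= (t - e) ^+ 2 + t * e.
  by rewrite addr_ge0 ?sqr_ge0// mulr_ge0 ?normr_ge0// ltW.
by rewrite (_ : _ + _ = t ^+ 2 + e * e - t * e) ?subr_ge0//; ring.
Qed.

End transfer_L2.

(** * Iterates of the Perron-Frobenius operator and conditional expectations on [Sigma_n] *)

Section perron_frobenius_iterates.
Context {d : measure_display} {T : measurableType d} {R : realType}.
Variables (mu : probability T R) (phi : T -> T).
Hypothesis phi_mp : measure_preserving mu phi.
Variable P : (T -> R) -> (T -> R).
Hypothesis HP : perron_frobenius mu phi P.
Implicit Types (f g : T -> R) (M : R).

Let mp n := measure_preserving_iter _ _ n phi_mp.

Lemma transfer_iter f n : L1 mu f -> transfer mu (iter n phi) f (iter n P f).
Proof.
move=> Lf; have [PL1 [_ [_ [_ Pint]]]] := HP.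
elim: n => [|n [_ LPf IHn]]; first by split.
split=> [//||A mA]; first exact: PL1.
have mB := measurable_preimage_mp _ _ _ phi_mp mA.
have -> : \int[mu]_(x in A) iter n.+1 P f x = \int[mu]_(x in phi @^-1` A) iter n P f x.
  by congr fine; exact: Pint.
exact: IHn.
Qed.

Lemma L1_iterP f n : L1 mu f -> L1 mu (iter n P f).
Proof. by move=> /(transfer_iter _ n)[]. Qed.

(* The conditional expectation of [f] with respect to [Sigma_n]. *)
Definition cond_exp_n f n := fun x => iter n P f (iter n phi x).

Lemma L1_cond_exp_n f n : L1 mu f -> L1 mu (cond_exp_n f n).
Proof. by move=> Lf; exact/(L1_comp _ _ (mp n))/L1_iterP. Qed.

Lemma dist1_cond_exp_n f g n : L1 mu f -> L1 mu g ->
  dist1 mu (cond_exp_n f n) (cond_exp_n g n) <= dist1 mu f g.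
Proof.
move=> Lf Lg; rewrite (dist1_comp _ _ (mp n)); [|exact: L1_iterP..].
exact: (dist1_transfer _ _ (mp n) _ _ _ _ (transfer_iter _ _ Lf) (transfer_iter _ _ Lg)).
Qed.

(** The squared L2 norms of [P^n f] decrease and are bounded below, and by Pythagoras a small drop
    of the squared norm means a small distance. *)
Lemma cond_exp_n_cauchy_bounded f M e : measurable_fun setT f ->
  (forall x, `|f x| <= M) -> 0 < e ->
  exists N, forall m n, (N <= m)%N -> (m <= n)%N ->
    dist1 mu (cond_exp_n f m) (cond_exp_n f n) <= e.
Proof.
move=> mf fM e0; have Lf := L1_bounded mu _ _ mf fM.
(* Bounded versions [q n] of [P^n f], since the L2 estimates ask for bounds at every point. *)
have /choice[q qP] : forall n, exists q, {ae mu, forall x, iter n P f x = q x} /\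
    (measurable_fun setT q /\ forall x, `|q x| <= M).
  move=> n; have [q q_ae qM] :=
    transfer_bounded_version _ _ (mp n) _ _ _ (transfer_iter _ n Lf) fM.
  by exists q.
have Lq n : L1 mu (q n) by have [_ [mq qM]] := qP n; exact: L1_bounded mq qM.
have qM n x : `|q n x| <= M by have [_ [_]] := qP n; apply.
have q_ae n : {ae mu, forall x, iter n P f x = q n x} by have [] := qP n.
have qq k m : transfer mu (iter k phi) (q m) (q (k + m)%N).
  apply: transfer_ae_eq (transfer_iter _ k (L1_iterP _ m Lf)) _ _ (q_ae m) _ => //.
  by rewrite -iterD.
pose a n := \int[mu]_x (q n x * q n x).
have a_le k m : a (k + m)%N <= a m.
  rewrite -subr_ge0 -(transfer_pythagoras _ _ (mp k) _ _ _ (qq k m) (qM _) (qM _)).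
  by apply: Rintegral_ge0 => x _; exact: sqr_ge0.
have a_inf : has_inf (range a).
  split; first by exists (a 0%N), 0%N.
  exists 0 => _ [n _ <-]; apply: Rintegral_ge0 => x _.
  by rewrite -expr2 sqr_ge0.
have e20 : 0 < e / 2 by rewrite divr_gt0.
(* With [a N] within [(e / 2) ^+ 2] of the infimum, [dist1_transfer_L2] at [e / 2] yields
   [e / 2 + (e / 2) ^+ 2 / (e / 2)], which is [e]. *)
have [_ [N _ <-] aN] := inf_adherent (mulr_gt0 e20 e20) a_inf.
exists N => m n Nm mn; rewrite -(subnK mn); set k := (n - m)%N.
have Lm := L1_iterP _ m Lf; have Ln := L1_iterP _ (k + m) Lf.
have Lnk := L1_comp _ _ (mp k) _ Ln; have Lqk := L1_comp _ _ (mp k) _ (Lq (k + m)%N).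
(* Both functions are compositions with [iter m phi], which preserves distances. *)
have -> : dist1 mu (cond_exp_n f m) (cond_exp_n f (k + m)) =
    dist1 mu (iter m P f) (fun x => iter (k + m) P f (iter k phi x)).
  rewrite -(dist1_comp _ _ (mp m) _ _ Lm Lnk).
  by apply: eq_Rintegral => x _; rewrite /cond_exp_n [iter (k + m) phi _]iterD.
apply: (le_trans (dist1_triangle _ _ _ _ Lm (Lq m) Lnk)).
rewrite (ae_eq_dist1 _ _ _ Lm (Lq m) (q_ae m)) add0r.
apply: (le_trans (dist1_triangle _ _ _ _ (Lq m) Lqk Lnk)).
rewrite (dist1_comp _ _ (mp k) _ _ (Lq _) Ln) [X in _ + X]dist1C.
rewrite (ae_eq_dist1 _ _ _ Ln (Lq _) (q_ae _)) addr0.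
apply: (le_trans (dist1_transfer_L2 _ _ (mp k) _ _ _ _ (qq k m) (qM _) (qM _) e20)).
rewrite [leRHS]splitr lerD2l ler_pdivrMr// lerBlDr addrC.
have aNm : a m <= a N by rewrite -(subnK Nm).
by rewrite (le_trans aNm)// (le_trans (ltW aN))// lerD2r; apply: ge_inf; [case: a_inf|exists (k + m)%N].
Qed.

Lemma cond_exp_n_cauchy f e : L1 mu f -> 0 < e ->
  exists N, forall m n, (N <= m)%N -> (N <= n)%N ->
    dist1 mu (cond_exp_n f m) (cond_exp_n f n) <= e.
Proof.
move=> Lf e0; have e30 : 0 < e / 3 by rewrite divr_gt0.
have [s [Ls fs]] := L1_sfun_approx _ _ _ Lf e30.
have [M [_ sM]] := simple_bounded s.
(* Boundedness provides the estimate for every number strictly above [M], hence the choice of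
   [M + 1]. *)
have {}sM x : `|s x| <= M + 1 by apply: sM => //; rewrite ltrDl.
have [N sN] := cond_exp_n_cauchy_bounded _ _ _ (L1_measurable _ _ Ls) sM e30.
exists N => m n Nm Nn; wlog mn : m n Nm Nn / (m <= n)%N.
  by move=> H; case: (leqP m n) => [|/ltnW] ?; [|rewrite dist1C]; exact: H.
have Hf k := L1_cond_exp_n _ k Lf; have Hs k := L1_cond_exp_n _ k Ls.
have fsn k : dist1 mu (cond_exp_n f k) (cond_exp_n s k) <= e / 3.
  exact: le_trans (dist1_cond_exp_n _ _ _ Lf Ls) fs.
apply: (le_trans (dist1_triangle _ _ _ _ (Hf m) (Hs m) (Hf n))).
have -> : e = e / 3 + (e / 3 + e / 3) by field.
apply: lerD => //.
apply: (le_trans (dist1_triangle _ _ _ _ (Hs m) (Hs n) (Hf n))).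
by apply: lerD; [exact: sN|rewrite dist1C].
Qed.

End perron_frobenius_iterates.

(** * Limits superior and inferior, and sequences with summable increments *)

Section fast_cauchy.
Context {R : realType}.

Lemma limn_einf_le (u : (\bar R)^nat) (e : \bar R) :
  (\forall n \near \oo, u n <= e)%E -> (limn_einf u <= e)%E.
Proof.
move=> [N _ uN]; rewrite limn_einf_lim; apply: lime_le; first exact: is_cvg_einfs.
apply: nearW => n; apply: (@le_trans _ _ (u (maxn n N))).
  by apply: ereal_inf_lbound; exists (maxn n N) => //=; exact: leq_maxl.
by apply: uN => /=; exact: leq_maxr.
Qed.

(** Allows the first [m] terms to be dropped when a limit superior has to factor through
    [iter m phi]. *)
Lemma limn_esup_shift (u : (\bar R)^nat) m :
  limn_esup (fun n => u (n + m)%N) = limn_esup u.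
Proof.
rewrite !limn_esup_lim; apply/cvg_lim => //.
suff -> : esups (fun n => u (n + m)%N) = fun n => esups u (n + m)%N.
  by rewrite (cvg_shiftn m (esups u)); exact: is_cvg_esups.
apply/funext => n; congr ereal_sup; apply/seteqP; split => _ [k /= nk <-].
  by exists (k + m)%N => //=; rewrite leq_add2r.
have mk : (m <= k)%N by rewrite (leq_trans _ nk)// leq_addl.
by exists (k - m)%N; rewrite /= ?subnK// -(leq_add2r m) subnK.
Qed.

(** Up to its first term, [v] is the sequence of partial sums of an absolutely convergent series. *)
Lemma cvgn_summable_increments (v : R^nat) :
  (\sum_(0 <= k <oo) `|v k.+1 - v k|%:E)%E \is a fin_num -> cvgn v.
Proof.
move=> sum_fin; have : cvgn (series (telescope v)).
  apply: normed_cvg; apply: nondecreasing_is_cvgn.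
    by apply: nondecreasing_series => n _ _; exact: normr_ge0.
  exists (fine (\sum_(0 <= k <oo) `|v k.+1 - v k|%:E)%E) => _ [n _ <-].
  rewrite -lee_fin fineK// /series/= -sumEFin.
  by apply: nneseries_lim_ge => k _ _; rewrite lee_fin.
rewrite telescopeK => vv; rewrite (_ : v = (fun n => (v n - v 0%N) + v 0%N)).
  by apply: is_cvgD => //; exact: is_cvg_cst.
by apply/funext => n; rewrite subrK.
Qed.

End fast_cauchy.

(** * Completeness of L1 *)

Section completeness.
Context {d : measure_display} {T : measurableType d} {R : realType}.
Variable mu : probability T R.

(* Riesz-Fischer, with the limit given explicitly as the limit superior of a
   subsequence so that measurability properties of the sequence are inherited. *)
Lemma L1_complete (u : nat -> T -> R) : (forall n, L1 mu (u n)) ->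
  (forall e, 0 < e -> exists N, forall m n, (N <= m)%N -> (N <= n)%N ->
    dist1 mu (u m) (u n) <= e) ->
  exists r : nat -> nat, (forall k, (k <= r k)%N) /\
    let h x := fine (limn_esup (fun k => (u (r k) x)%:E)) in
    L1 mu h /\ forall e, 0 < e -> \forall n \near \oo, dist1 mu (u n) h <= e.
Proof.
move=> Lu cauchy_u.
have /choice[N uN] : forall k, exists N, forall m n, (N <= m)%N -> (N <= n)%N ->
    dist1 mu (u m) (u n) <= 1 / (2 ^ k.+1)%:R.
  by move=> k; apply: cauchy_u; rewrite divr_gt0// ltr0n expn_gt0.
(* The sum makes [r] nondecreasing and at least [N], and the extra [k] gives [k <= r k]. *)
pose r k := (\sum_(i < k.+1) N i + k)%N.
have rS k : (r k <= r k.+1)%N by rewrite /r [in leqRHS]big_ord_recr/= addnS leqW// leq_add2r leq_addr.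
have Nr k : (N k <= r k)%N by rewrite /r big_ord_recr/= -addnA addnCA leq_addr.
have kr k : (k <= r k)%N by exact: leq_addl.
exists r; split=> // h.
have mur k : measurable_fun setT (u (r k)) by exact: (L1_measurable mu).
have mE k : measurable_fun setT (fun x => `|u (r k.+1) x - u (r k) x|%:E).
  by apply/measurable_EFinP/measurableT_comp => //; exact: measurable_funB.
have ae_cvg : {ae mu, forall x, cvgn (fun k => u (r k) x)}.
  (* The increments along [r] have integrals at most [1 / 2 ^ k.+1], of total 1, so their sum is
     finite almost everywhere. *)
  have /integrable_ae : mu.-integrable setT
      (fun x => \sum_(0 <= k <oo) `|u (r k.+1) x - u (r k) x|%:E)%E.
    apply/integrableP; split; first by apply: ge0_emeasurable_sum => // k x _ _; rewrite lee_fin.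
    rewrite (eq_integral (fun x => \sum_(0 <= k <oo) `|u (r k.+1) x - u (r k) x|%:E)%E); last first.
      by move=> x _; rewrite gee0_abs// nneseries_ge0// => k _ _; rewrite lee_fin.
    rewrite integral_nneseries//.
    apply: (@le_lt_trans _ _ (1%R)%:E); last exact: ltry.
    apply: le_trans (@epsilon_trick0 R 1 xpredT _) => //.
    apply: lee_nneseries => k _; first by move=> _; exact: integral_ge0.
    rewrite (L1_Rintegral _ _ setT)//; last exact/L1_norm/L1B.
    by rewrite lee_fin uN// (leq_trans _ (rS k)).
  move=> /(_ measurableT); apply: filterS => x /(_ I).
  exact: cvgn_summable_increments.
have mh : measurable_fun setT h.
  apply: measurableT_comp => //.
  by apply: measurable_fun_limn_esup => k; exact/measurable_EFinP.
have ae_h : {ae mu, forall x, u (r k) x @[k --> \oo] --> h x}.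
  apply: filterS ae_cvg => x /= /cvg_ex[l ul].
  have /cvg_limn_einf_sup[_ lim_l] : (u (r k) x)%:E @[k --> \oo] --> l%:E.
    by apply: cvg_EFin => //; exact: nearW.
  by rewrite /h lim_l.
(* By Fatou's lemma the distance from [u n] to the pointwise limit is at most the limit inferior of
   its distances to the subsequence. *)
have fatou_u n e : 0 < e -> (\forall k \near \oo, dist1 mu (u n) (u (r k)) <= e) ->
    (\int[mu]_x `|u n x - h x|%:E <= e%:E)%E.
  move=> e0 dist_e.
  pose F k x := `|u n x - u (r k) x|%:E.
  have mF k : measurable_fun setT (F k).
    apply/measurable_EFinP/measurableT_comp => //; apply: measurable_funB => //.
    exact: (L1_measurable mu).
  have F0 k x : setT x -> (0 <= F k x)%E by rewrite lee_fin.
  have -> : (\int[mu]_x `|u n x - h x|%:E = \int[mu]_x limn_einf (F ^~ x))%E.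
    apply: ge0_ae_eq_integral => //.
    - apply/measurable_EFinP/measurableT_comp => //; apply: measurable_funB => //.
      exact: (L1_measurable mu).
    - apply: measurableT_comp => //; apply: measurable_fun_limn_esup => k.
      exact: measurableT_comp.
    - move=> x _; apply: (@le_trans _ _ (limn_einf (fun=> 0%E : \bar R))).
        by have [-> _] := cvg_limn_einf_sup (@cvg_cst _ (0%E : \bar R) _ _ _).
      rewrite !limn_einf_lim; apply: lee_lim; [exact: is_cvg_einfs..|].
      apply: nearW => k; apply: le_ereal_inf_tmp => _ [j /= kj <-].
      apply: (@le_trans _ _ 0%E); last by rewrite lee_fin.
      by apply: ereal_inf_lbound; exists j.
    - apply: filterS ae_h => x uh _.
      suff /cvg_limn_einf_sup[-> _] : F k x @[k --> \oo] --> `|u n x - h x|%:E by [].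
      apply: cvg_EFin; first exact: nearW.
      by apply: cvg_norm; apply: cvgB => //; exact: cvg_cst.
  apply: (le_trans (fatou mu measurableT mF F0)); apply: limn_einf_le.
  apply: filterS dist_e => k; rewrite -lee_fin; apply: le_trans.
  by rewrite (L1_Rintegral _ _ setT)//; exact/L1_norm/L1B.
have near_fatou e : 0 < e -> exists M, forall n, (M <= n)%N ->
    (\int[mu]_x `|u n x - h x|%:E <= e%:E)%E.
  move=> e0; have [M uM] := cauchy_u _ e0; exists M => n Mn; apply: fatou_u => //.
  by exists M => // k /= Mk; apply: uM => //; exact: leq_trans (kr k).
have Lh : L1 mu h.
  (* One finite distance suffices: [h] is the difference of the integrable functions [u M] and
     [u M - h]. *)
  have [M /(_ M (leqnn _)) uMh] := near_fatou _ ltr01.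
  have LMh : L1 mu (fun x => u M x - h x).
    apply/integrableP; split; last exact: le_lt_trans uMh (ltry _).
    by apply/measurable_EFinP/measurable_funB => //; exact: (L1_measurable mu).
  have := L1B _ _ _ (Lu M) LMh; apply: eq_integrable => // x _ /=.
  by rewrite opprB addrC subrK.
split=> // e e0; have [M uM] := near_fatou _ e0; exists M => // n /= Mn.
by rewrite -lee_fin /dist1 -L1_Rintegral//; [exact: uM|exact/L1_norm/L1B].
Qed.

End completeness.

(** * Almost invariant functions and conditional expectation on [Sigma_inv] *)

Section invariant_functions.
Context {d : measure_display} {T : measurableType d} {R : realType}.
Variables (mu : probability T R) (phi : T -> T).
Hypothesis phi_mp : measure_preserving mu phi.
Implicit Types (f g h : T -> R).

(** Where [h (phi x)] and [h x] differ, a rational separates them, so [x] lies in one of countably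
    many null sets. *)
Lemma ae_invariant_level_sets h :
  (forall q : R, mu.-negligible ([set x | q < h x] `+` phi @^-1` [set x | q < h x])) ->
  {ae mu, forall x, h (phi x) = h x}.
Proof.
move=> level_inv.
have [e e_surj] : exists e : nat -> option rat, forall q, exists n, e n = Some q.
  by exists choice.unpickle => q; exists (choice.pickle q); exact: choice.pickleK.
pose F n := if e n is Some q then
  [set x | ratr q < h x] `+` phi @^-1` [set x | ratr q < h x] else set0.
apply: (@negligibleS _ _ _ _ (\bigcup_n F n)); last first.
  apply: negligible_bigcup => n; rewrite /F; case: (e n) => [q|].
    exact: level_inv.
  exact: negligible_set0.
move=> x /= /eqP; rewrite neq_lt => /orP[] /rat_in_itvoo[q];
  rewrite in_itv/= => /andP[lq ql]; have [n enq] := e_surj q;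
  exists n => //; rewrite /F enq; [left|right]; split => //=;
  by apply/negP; rewrite -leNgt ltW.
Qed.

Lemma ae_invariant_iter h n : L1 mu h -> {ae mu, forall x, h (phi x) = h x} ->
  dist1 mu (fun x => h (iter n phi x)) h = 0.
Proof.
move=> Lh hphi; have Lhn k := L1_comp _ _ (measure_preserving_iter _ _ k phi_mp) _ Lh.
elim: n => [|n IHn]; first by apply: ae_eq_dist1 => //; exact: aeW.
apply/eqP; rewrite eq_le dist1_ge0 andbT.
apply: (le_trans (dist1_triangle _ _ _ _ (Lhn n.+1) (Lhn n) Lh)); rewrite IHn addr0.
rewrite (dist1_comp _ _ (measure_preserving_iter _ _ n phi_mp) _ _ (Lhn 1%N) Lh).
by rewrite (ae_eq_dist1 _ _ _ (Lhn 1%N)).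
Qed.

Lemma Rintegral_setY0 f A B : L1 mu f -> measurable A -> measurable B ->
  mu (A `+` B) = 0%E -> \int[mu]_(x in A) f x = \int[mu]_(x in B) f x.
Proof.
move=> Lf mA mB AB; rewrite -(Rintegral_indic_mul _ f A)// -(Rintegral_indic_mul _ f B)//.
have L1i C : measurable C -> L1 mu (fun x => f x * \1_C x).
  move=> mC; apply: (L1_le _ _ f) => // [|x].
    by apply: measurable_funM; [exact: (L1_measurable mu)|exact: measurable_indic].
  by rewrite indicE; case: (x \in C); rewrite ?mulr1// mulr0 normr0.
apply: ae_eq_Rintegral_in => //; [exact: L1i..|].
exists (A `+` B); split => //; first exact: measurable_setY.
move=> x /= nAB; apply: contrapT => nY; apply: nAB; congr (_ * _).
rewrite !indicE; congr (_%:R); congr nat_of_bool.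
apply/idP/idP => /set_mem xA; apply/mem_set; apply: contrapT => xB; apply: nY.
  by left.
by right.
Qed.

(** The level set of [g] through [x] is invariant exactly, not merely up to a null set, so the
    equality holds at every point. *)
Lemma cond_exp_inv_invariant f g x : is_cond_exp_inv mu phi f g -> g (phi x) = g x.
Proof.
move=> [_ [g_inv _]]; have [_ gx] := g_inv [set g x] (measurable_set1 _).
by have : (g @^-1` [set g x]) x by []; rewrite -gx.
Qed.

(** The set where [h >= g] is almost invariant, hence almost equal to an invariant [C]. The integral
    of [h - g] vanishes on [C] and on its complement, and so does that of [|h - g|]. *)
Lemma cond_exp_inv_unique f g h : is_cond_exp_inv mu phi f g -> L1 mu h ->
  {ae mu, forall x, h (phi x) = h x} ->
  (forall A, Sigma_inv phi A -> \int[mu]_(x in A) h x = \int[mu]_(x in A) f x) ->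
  dist1 mu h g = 0.
Proof.
move=> gf Lh hphi hf; have [Lg [_ g_int]] := gf.
have Lhg := L1B _ _ _ Lh Lg.
pose D := [set x | 0 <= h x - g x].
have mD : measurable D by exact: (L1_measurable_ge mu).
have mDphi := measurable_preimage_mp _ _ _ phi_mp mD.
have D0 : mu (D `+` phi @^-1` D) = 0%E.
  apply: measure_negligible; first exact: measurable_setY.
  apply: negligibleS hphi => x [[Dx nDx]|[Dx nDx]] /= hx; apply: nDx;
    move: Dx; by rewrite /preimage /D/= (cond_exp_inv_invariant _ _ _ gf) hx.
have [C [mC CC] DC] := almost_invariant_repr _ _ phi_mp _ mD D0.
have int0 A : Sigma_inv phi A -> \int[mu]_(x in A) (h x - g x) = 0.
  move=> invA; have mA : measurable A by case: invA.
  rewrite RintegralB//; [|exact: L1_in..]; rewrite hf//.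
  by rewrite (_ : \int[mu]_(x in A) g x = \int[mu]_(x in A) f x) ?subrr// /Rintegral g_int.
rewrite /dist1 (Rintegral_setC _ _ _ mD (L1_norm _ _ Lhg)).
rewrite (@eq_Rintegral _ _ _ mu D (fun x => h x - g x)); last first.
  by move=> x /set_mem Dx; rewrite ger0_norm//; exact: Dx.
rewrite (Rintegral_setY0 _ _ _ Lhg mD mC DC) int0// add0r.
have mDC := measurableC mD.
rewrite (@eq_Rintegral _ _ _ mu (~` D) (fun x => -1 * (h x - g x))); last first.
  move=> x /set_mem/= /negP; rewrite -ltNge => /ltW hg0.
  by rewrite ler0_norm// mulN1r.
rewrite RintegralZl//; last exact: L1_in.
rewrite (Rintegral_setY0 _ _ (~` C) Lhg)//; last 2 first.
- exact: measurableC.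
- rewrite -[RHS]DC /setY; congr (mu _).
  by rewrite !setDE !setCK setUC [C `&` _]setIC [~` C `&` _]setIC.
rewrite int0 ?mulr0//; split; first exact: measurableC.
by rewrite -preimage_setC CC.
Qed.

(** In other words, [P^n] undoes composition with [phi^n]. *)
Lemma transfer_composition n g : L1 mu g ->
  transfer mu (iter n phi) (fun x => g (iter n phi x)) g.
Proof.
move=> Lg; have mpn := measure_preserving_iter _ _ n phi_mp.
split=> //; first exact: L1_comp.
by move=> A mA; rewrite (Rintegral_comp _ _ mpn).
Qed.

Lemma malg_cvg_to_dist1 (S : nat -> set T) B :
  (forall n, measurable (S n)) -> measurable B ->
  (forall e, 0 < e -> \forall n \near \oo, dist1 mu \1_(S n) \1_B <= e) ->
  malg_cvg_to mu S B.
Proof.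
move=> mS mB SB; have L1i C : measurable C -> L1 mu \1_C by exact: integrable_indic.
have := (L1_cvg_toP mu (fun n => \1_(S n)) \1_B (fun n => L1i _ (mS n)) (L1i _ mB)).2 SB.
rewrite /L1_cvg_to /malg_cvg_to.
suff -> : (fun n => mu (S n `+` B)) =
    (fun n => \int[mu]_x `|\1_(S n) x - \1_B x|%:E)%E by [].
apply/funext => n; rewrite -dist1_indic// L1_Rintegral//.
by apply/L1_norm/L1B; exact: L1i.
Qed.

End invariant_functions.

(** * The limit of [P^n f], and images recovered from it *)

Section perron_frobenius_limit.
Context {d : measure_display} {T : measurableType d} {R : realType}.
Variables (mu : probability T R) (phi : T -> T).
Hypothesis phi_mp : measure_preserving mu phi.
Variable P : (T -> R) -> (T -> R).
Hypothesis HP : perron_frobenius mu phi P.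
Implicit Types (f g h : T -> R).

Let mp n := measure_preserving_iter _ _ n phi_mp.

(** Since [r (k + m) >= m], the terms from index [m] on are functions of [iter m phi x]. The limit
    superior thus factors as [H] after [iter m phi] at every point, and the level set is a preimage
    for each [m]. *)
Lemma level_set_Sigma_infty f (r : nat -> nat) (q : R) : L1 mu f ->
  (forall k, (k <= r k)%N) ->
  Sigma_infty phi
    [set x | q < fine (limn_esup (fun k => (cond_exp_n phi P f (r k) x)%:E))].
Proof.
move=> Lf kr m _.
pose H y := fine (limn_esup
  (fun k => (iter (r (k + m)) P f (iter (r (k + m) - m) phi y))%:E)).
have mH : measurable_fun setT H.
  apply: measurableT_comp => //; apply: measurable_fun_limn_esup => k.
  apply/measurable_EFinP/(L1_measurable mu)/(L1_comp _ _ (mp _)).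
  exact: (L1_iterP _ _ phi_mp _ HP).
exists [set y | q < H y].
  have := mH measurableT _ (measurable_itv `]q, +oo[); rewrite setTI.
  rewrite (_ : _ @^-1` _ = [set y | q < H y])//.
  by apply/seteqP; split => y; rewrite /= in_itv/= andbT.
suff HE x : H (iter m phi x) =
    fine (limn_esup (fun k => (cond_exp_n phi P f (r k) x)%:E)).
  by apply/seteqP; split => x /=; rewrite HE.
rewrite -[in RHS](limn_esup_shift _ m) /H; congr (fine (limn_esup _)).
apply/funext => k; rewrite /cond_exp_n -iterD subnK//.
by rewrite (leq_trans _ (kr _))// leq_addl.
Qed.

Lemma perron_frobenius_cvg f :
  (forall A, Sigma_infty phi A -> completion_in mu (Sigma_inv phi) A) ->
  L1 mu f -> exists h, [/\ L1 mu h, {ae mu, forall x, h (phi x) = h x} &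
    L1_cvg_to mu (fun n => iter n P f) h].
Proof.
move=> infI Lf; have Lfn n := L1_cond_exp_n _ _ phi_mp _ HP _ n Lf.
have [r [kr [Lh cvg_h]]] := L1_complete _ _ Lfn
  (fun e => cond_exp_n_cauchy _ _ phi_mp _ HP _ e Lf).
set h := (fun x => fine _) in Lh cvg_h.
have h_inv : {ae mu, forall x, h (phi x) = h x}.
  apply: ae_invariant_level_sets => q.
  have SA := level_set_Sigma_infty _ _ q Lf kr.
  have mA := Sigma_infty_measurable _ _ SA.
  apply/negligibleP.
    by apply: measurable_setY => //; exact: (measurable_preimage_mp mu).
  exact/(completion_Sigma_inv_almost_invariant _ _ phi_mp)/infI.
exists h; split => //; have LPf n := L1_iterP _ _ phi_mp _ HP _ n Lf.
apply/L1_cvg_toP => // e e0; apply: filterS (cvg_h _ e0) => n; apply: le_trans.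
(* Composing with [phi^n] turns [P^n f] into the conditional expectation and changes [h] only on a
   null set. *)
rewrite -(dist1_comp _ _ (mp n) _ _ (LPf n) Lh).
have Lhn := L1_comp _ _ (mp n) _ Lh.
apply: (le_trans (dist1_triangle _ _ _ _ (Lfn n) Lh Lhn)).
by rewrite [X in _ + X]dist1C ae_invariant_iter// addr0.
Qed.

(** An invariant [A] equals [phi^-n A], so all [P^n f] have the integral of [f] over [A], and the L1
    limit inherits it. *)
Lemma limit_Rintegral_inv f h A : L1 mu f -> L1 mu h ->
  L1_cvg_to mu (fun n => iter n P f) h -> Sigma_inv phi A ->
  \int[mu]_(x in A) h x = \int[mu]_(x in A) f x.
Proof.
move=> Lf Lh; have LPf n := L1_iterP _ _ phi_mp _ HP _ n Lf.
move=> /(L1_cvg_toP _ _ _ LPf Lh) cvg_h [mA AA].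
apply/eqP; rewrite -subr_eq0 -normr_le0; apply/ler_addgt0Pl => e e0; rewrite addr0.
have [n _ /(_ n (leqnn n)) hn] := cvg_h _ e0.
have [_ _ /(_ _ mA)] := transfer_iter _ _ phi_mp _ HP _ n Lf.
rewrite preimage_iter_inv// => <-.
rewrite -RintegralB//; [|exact: L1_in..]; apply: le_trans hn.
have Lhn := L1B _ _ _ Lh (LPf n).
apply: (le_trans (le_normr_Rintegral mA (L1_in _ _ _ mA Lhn))).
rewrite dist1C /dist1 (Rintegral_setC _ _ _ mA (L1_norm _ _ Lhn)) lerDl.
exact: Rintegral_ge0.
Qed.

Lemma perron_frobenius_cvg_cond_exp f g :
  (forall A, Sigma_infty phi A -> completion_in mu (Sigma_inv phi) A) ->
  L1 mu f -> is_cond_exp_inv mu phi f g -> L1_cvg_to mu (fun n => iter n P f) g.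
Proof.
move=> infI Lf gf; have Lg : L1 mu g by case: gf.
have [h [Lh h_inv cvg_h]] := perron_frobenius_cvg _ infI Lf.
have hg := cond_exp_inv_unique _ _ phi_mp _ _ _ gf Lh h_inv
  (fun A => limit_Rintegral_inv _ _ A Lf Lh cvg_h).
have LPf n := L1_iterP _ _ phi_mp _ HP _ n Lf.
move: cvg_h => /(L1_cvg_toP _ _ _ LPf Lh) cvg_h.
apply/L1_cvg_toP => // e e0; apply: filterS (cvg_h _ e0) => n; apply: le_trans.
by apply: (le_trans (dist1_triangle _ _ _ _ (LPf n) Lh Lg)); rewrite hg addr0.
Qed.

Lemma perron_frobenius_cvg_image A g : bimeasurable phi -> Sigma_infty phi A ->
  L1 mu g -> L1_cvg_to mu (fun n => iter n P \1_A) g ->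
  exists2 B, measurable B & malg_cvg_to mu (fun n => iter n phi @` A) B.
Proof.
move=> phi_bi SA Lg cvg_g; have mA := Sigma_infty_measurable _ _ SA.
have mAn n := measurable_image_iter _ n _ phi_bi mA.
have L1i C : measurable C -> L1 mu \1_C by exact: integrable_indic.
have LPA n := L1_iterP _ _ phi_mp _ HP _ n (L1i _ mA).
move: cvg_g => /(L1_cvg_toP _ _ _ LPA Lg) cvg_g.
(* By saturation [1_A] is the indicator of [phi^n A] composed with [phi^n], and transferring it
   gives that indicator back. *)
have PA n : dist1 mu \1_(iter n phi @` A) (iter n P \1_A) = 0.
  apply/eqP; rewrite eq_le dist1_ge0 andbT.
  have -> : 0 = dist1 mu \1_A \1_A by rewrite ae_eq_dist1//; [exact: L1i..|exact: aeW].
  apply: (dist1_transfer _ _ (mp n)); last exact: (transfer_iter _ _ phi_mp _ HP _ n (L1i _ mA)).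
  rewrite -[in X in transfer _ _ X](Sigma_infty_image phi A n)//.
  exact: (transfer_composition _ _ phi_mp n _ (L1i _ (mAn n))).
(* Thresholding at one half: wherever the indicators of [phi^n A] and [B] differ, [g] is at least
   [1 / 2] away from the former, whence the factor 2 below. *)
pose B := [set x | 1 / 2 <= g x]; have mB : measurable B by exact: (L1_measurable_ge mu).
exists B => //; apply: malg_cvg_to_dist1 => // e e0.
have e20 : 0 < e / 2 by rewrite divr_gt0.
apply: filterS (cvg_g _ e20) => n Pg.
have Lgn : L1 mu (fun x => \1_(iter n phi @` A) x - g x) by apply: L1B => //; exact: L1i.
apply: (@le_trans _ _ (2 * dist1 mu \1_(iter n phi @` A) g)).
  rewrite -RintegralZl//; last exact: L1_norm.
  apply: le_Rintegral => //; [by apply/L1_norm/L1B; exact: L1i|exact/L1Z/L1_norm|].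
  move=> x _; rewrite !indicE; have [/set_mem|/negP] := boolP (x \in B).
    rewrite /B/= => gx; case: (x \in _) => /=; first by rewrite subrr normr0 mulr_ge0.
    rewrite !sub0r !normrN normr1 (le_trans _ (ler_wpM2l _ (ler_norm _)))//; lra.
  move=> nB; have {nB} gx : g x < 1 / 2.
    by rewrite ltNge; apply/negP => gx; apply: nB; exact: mem_set.
  case: (x \in _) => /=; last by rewrite subrr normr0 mulr_ge0.
  rewrite subr0 normr1 (le_trans _ (ler_wpM2l _ (ler_norm _)))//; lra.
rewrite mulrC -ler_pdivlMr//; apply: le_trans Pg.
apply: (le_trans (dist1_triangle _ _ _ _ (L1i _ (mAn n)) (LPA n) Lg)).
by rewrite PA add0r.
Qed.

End perron_frobenius_limit.

(** * Equivalence of the three assertions and identification of the limits *)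

Theorem theorem1p1 (d : measure_display) (T : measurableType d) (R : realType)
  (mu : probability T R) (phi : T -> T)
  (Hmp : measure_preserving mu phi) (Hbi : bimeasurable phi)
  (P : (T -> R) -> (T -> R)) (HP : perron_frobenius mu phi P) :
  let cond_i := forall A, measurable A ->
      exists2 B, measurable B & malg_cvg_to mu (fun n => iter n phi @` A) B in
  let cond_ii := forall f, L1 mu f ->
      exists2 g, L1 mu g & L1_cvg_to mu (fun n => iter n P f) g in
  let cond_iii := completion_in mu (Sigma_infty phi) = completion_in mu (Sigma_inv phi) in
  ((cond_i <-> cond_ii) /\ (cond_ii <-> cond_iii)) /\
  (cond_i ->
     (forall f g, L1 mu f -> is_cond_exp_inv mu phi f g ->
        L1_cvg_to mu (fun n => iter n P f) g) /\
     (forall A, measurable A ->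
        malg_cvg_to mu (fun n => iter n phi @` A) (min_inv_superset phi A))).
Proof.
(* Every assertion is compared with a single one: each set of [Sigma_infty] is almost equal to an
   invariant set. *)
have i_infI : (forall A, measurable A ->
    exists2 B, measurable B & malg_cvg_to mu (fun n => iter n phi @` A) B) ->
    forall A, Sigma_infty phi A -> completion_in mu (Sigma_inv phi) A.
  move=> i A SA; have [B mB AB] := i A (Sigma_infty_measurable _ _ SA).
  exact: (malg_limit_completion _ _ Hmp Hbi _ _ SA mB AB).
have infI_i : (forall A, Sigma_infty phi A -> completion_in mu (Sigma_inv phi) A) ->
    forall A, measurable A ->
    exists2 B, measurable B & malg_cvg_to mu (fun n => iter n phi @` A) B.
  move=> infI A mA; have [mA' cvgA] := malg_cvg_min_inv_superset _ _ Hmp Hbi _ mA infI.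
  by exists (min_inv_superset phi A).
have infI_ii : (forall A, Sigma_infty phi A -> completion_in mu (Sigma_inv phi) A) ->
    forall f, L1 mu f -> exists2 g, L1 mu g & L1_cvg_to mu (fun n => iter n P f) g.
  move=> infI f Lf; have [h [Lh _ cvg_h]] := perron_frobenius_cvg _ _ Hmp _ HP _ infI Lf.
  by exists h.
have ii_infI : (forall f, L1 mu f ->
    exists2 g, L1 mu g & L1_cvg_to mu (fun n => iter n P f) g) ->
    forall A, Sigma_infty phi A -> completion_in mu (Sigma_inv phi) A.
  move=> ii A SA; have mA := Sigma_infty_measurable _ _ SA.
  have [g Lg cvg_g] := ii \1_A (integrable_indic mu mA).
  have [B mB AB] := perron_frobenius_cvg_image _ _ Hmp _ HP _ _ Hbi SA Lg cvg_g.
  exact: (malg_limit_completion _ _ Hmp Hbi _ _ SA mB AB).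
have infI_iii := completion_Sigma_infty_invE mu phi.
move=> cond_i cond_ii cond_iii; split; [split; split|].
- by move=> /i_infI /infI_ii.
- by move=> /ii_infI /infI_i.
- by move=> /ii_infI /infI_iii.
- by move=> /infI_iii /infI_ii.
move=> /i_infI infI; split => [f g|A mA].
  exact: (perron_frobenius_cvg_cond_exp _ _ Hmp _ HP _ _ infI).
by have [] := malg_cvg_min_inv_superset _ _ Hmp Hbi _ mA infI.
Qed.
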